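(* There exist transcendental entire functions $f$ and $g$ and a domain in $\mathbb{C}$ which lies in a periodic component of $F(f)$ and in a wandering component of $F(g)$, and lies in a preperiodic component of $F(g\circ f)$ and in a periodic component of $F(f\circ g)$.
   Context: A domain is a nonempty open connected subset of $\mathbb{C}$. For a transcendental entire function $h$, $h^n$ denotes its $n$-th iterate, and the Fatou set is $F(h)=\{z\in\mathbb{C}: \{h^n\}_{n\in\mathbb{N}} \text{ is normal in some neighborhood of } z\}$. A component of $F(h)$ means a connected component. For a component $U$ of $F(h)$ and $k\ge 0$, let $U_k$ denote the component of $F(h)$ containing $h^k(U)$ (so $U_0=U$). The component $U$ is called wandering if $U_k\cap U_l=\emptyset$ for all $k\neq l$; otherwise it is called preperiodic. It is called periodic if $U_k=U$ for some $k\ge 1$. A domain lies in a wandering (resp. periodic, preperiodic) component of $h$ if it is contained in some wandering (resp. periodic, preperiodic) component of $F(h)$. If $f,g$ are transcendental entire, so are $f\circ g$ and $g\circ f$, and these notions apply to them. *)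

(* Defs.v *)
From HB Require Import structures.
From mathcomp Require Export all_boot all_order all_algebra.
From mathcomp Require Export complex.
From mathcomp Require Export all_classical all_reals all_analysis.
Export numFieldNormedType.Exports.

Set Implicit Arguments.
Unset Strict Implicit.
Unset Printing Implicit Defensive.

Import Order.TTheory GRing.Theory Num.Theory.
Local Open Scope classical_set_scope.
Local Open Scope ring_scope.
Local Open Scope complex_scope.

Section EntireDynamics.
Variable R : realType.
Local Notation C := R[i]^o.
Implicit Types (h : C -> C) (D U V K : set C) (k : nat).

Definition domain D : Prop := [/\ D !=set0, open D & connected D].

(* The scalar field of the normed module [R[i]^o] is [R[i]], so that
   [derivable h z 1] is complex differentiability of [h] at [z]. *)
Definition entire h : Prop := forall z : C, derivable h z 1.

Definition transcendental_entire h : Prop :=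
  entire h /\ ~ exists p : {poly R[i]}, forall z, h z = p.[z].

(* Locally uniform convergence on an open set [V], as uniform convergence on
   the compact subsets of [V]. *)
Definition loc_unif_cvg V (u : nat -> C -> C) h : Prop :=
  forall K, compact K -> K `<=` V -> {uniform K, u @ \oo --> h}.

Definition loc_unif_cvg_infty V (u : nat -> C -> C) : Prop :=
  forall K, compact K -> K `<=` V ->
  forall M : R, \forall n \near \oo, forall z, K z -> M%:C <= `|u n z|.

(* Normality for families of holomorphic functions, the constant infinity
   being allowed as a limit. *)
Definition normal_family V (F : set (C -> C)) : Prop :=
  forall u : nat -> C -> C, (forall n, F (u n)) ->
  exists s : nat -> nat, {homo s : m n / (m < n)%N} /\
    ((exists l : C -> C, loc_unif_cvg V (u \o s) l) \/
     loc_unif_cvg_infty V (u \o s)).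

Definition Fatou h : set C :=
  [set z | exists V, [/\ open V, V z &
     normal_family V (range (fun n => iter n h))]].

Definition Fatou_component h U : Prop :=
  exists2 z, Fatou h z & U = connected_component (Fatou h) z.

(* The component [U_k]: for [U] a component of the Fatou set of a
   transcendental entire [h], there is exactly one component containing
   [h^k(U)], so that the default value [set0] is never used. *)
Definition component_iter h U k : set C :=
  xget set0 [set V | Fatou_component h V /\ iter k h @` U `<=` V].

Definition wandering h U : Prop :=
  Fatou_component h U /\
  forall k l, k <> l -> component_iter h U k `&` component_iter h U l = set0.

Definition preperiodic h U : Prop :=
  Fatou_component h U /\ ~ wandering h U.

Definition periodic h U : Prop :=
  Fatou_component h U /\ exists2 k, (1 <= k)%N & component_iter h U k = U.

Definition lies_in (P : (C -> C) -> set C -> Prop) h D : Prop :=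
  exists2 U, P h U & D `<=` U.

End EntireDynamics.

(* Main.v *)
Require Import Defs.
From mathcomp Require Import ring lra.

(** Write [h z = z + 1 - e^z], Newton's map for [e^(-z) - 1].  It commutes with the
    translation by [2 pi i] and fixes the points [2 pi i k], where its derivative
    is [0].  The theorem holds for the explicit maps [f z = (e^z - 1) / 3] and
    [g z = h z + 2 pi i] and the disc [D] of radius [1/8] around [0].

    Both [f] and [h] at least halve the modulus on [D], and [f] has period
    [2 pi i].  Therefore [f] and [f o g = f o h] attract [D] to the fixed point
    [0], while [g o f] maps [D] into [D + 2 pi i], which it attracts to the fixed
    point [2 pi i].  The points of the component of the Fatou set containing an
    attracting fixed point are all attracted by it: at a boundary point of the
    basin inside the Fatou set, a locally uniform limit of iterates would be
    continuous and equal to the fixed point on the basin, hence at the boundary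
    point ([Fatou_closure_basin]).  So the images of such components are again
    contained in components, which settles the assertions on [f], [f o g] and
    [g o f].

    The iterates of [g] are those of [h] followed by translations, so [g] maps
    the disc around [2 pi i k] into the disc around [2 pi i (k + 1)] and its
    iterates tend to infinity uniformly on [D].  It remains to show that no two of
    these discs lie in one component, and for this that the horizontal lines at
    the odd multiples of [pi], which separate them, avoid the Fatou set
    ([line_not_Fatou]).  Such a line is invariant under [h], which acts on it by
    [x |-> x + 1 + e^x], so its points escape under [g].  It is also repelling:
    [h] expands near [x] by a factor of order [e^x], so the images under the
    iterates of [h] of any neighbourhood [V] of a point of the line finally
    contain discs of radius [4] around points of the line arbitrarily far to the
    right, and then, one step later, huge discs that meet any given vertical
    lattice [p + 2 pi i Z] ([newton_meets_lattice]).  If [e^p = 1 + 2 pi i], then [g] fixes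
    every point of that lattice.  Thus [V] contains both an escaping point and a
    point with bounded orbit, and the iterates of [g] are not normal on [V]
    ([not_normal_bounded_escaping]).  All coverings used come from one elementary
    lemma on maps with nonvanishing derivative ([covering]). *)

Import Order.TTheory GRing.Theory Num.Theory.

Set Implicit Arguments.
Unset Strict Implicit.
Unset Printing Implicit Defensive.

Local Open Scope classical_set_scope.
Local Open Scope ring_scope.
Local Open Scope complex_scope.

(** * Topology of the plane in terms of the real modulus *)

Section Modulus.
Variable R : realType.
Local Notation C := R[i]^o.
Local Notation nc := (@Normc.normc R).
Implicit Types (z w : C).

Lemma norm_normc z : `|z| = (nc z)%:C.
Proof. by case: z. Qed.

Lemma normc_ge0 z : 0 <= nc z.
Proof. by case: z => a b; exact: sqrtr_ge0. Qed.

Lemma normcB z w : nc (z - w) = nc (w - z).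
Proof. by rewrite -[in LHS]opprB normcN. Qed.

Lemma normc_triangle z w : nc (z + w) <= nc z + nc w.
Proof. exact: le_normcD. Qed.

Lemma normc_triangleB z w : nc z - nc w <= nc (z + w).
Proof.
have := le_normcD (z + w) (- w); rewrite addrK normcN; lra.
Qed.

Lemma normc_dist u z w : nc (z - w) <= nc (z - u) + nc (u - w).
Proof. by have := le_normcD (z - u) (u - w); rewrite addrA subrK. Qed.

Lemma normc_real (x : R) : nc x%:C = `|x|.
Proof. by rewrite /= expr0n /= addr0 sqrtr_sqr. Qed.

Lemma normc_sqr z : nc z ^+ 2 = complex.Re z ^+ 2 + complex.Im z ^+ 2.
Proof. by case: z => a b; rewrite sqr_sqrtr // addr_ge0 // sqr_ge0. Qed.

Lemma normRe_le z : `|complex.Re z| <= nc z.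
Proof.
rewrite -(ler_pXn2r (n:=2)) ?nnegrE ?normc_ge0 // normc_sqr -normrX.
by rewrite ger0_norm ?sqr_ge0 // lerDl sqr_ge0.
Qed.

Lemma normIm_le z : `|complex.Im z| <= nc z.
Proof.
rewrite -(ler_pXn2r (n:=2)) ?nnegrE ?normc_ge0 // normc_sqr -normrX.
by rewrite ger0_norm ?sqr_ge0 // lerDr sqr_ge0.
Qed.

Lemma normc_le_ReIm z : nc z <= `|complex.Re z| + `|complex.Im z|.
Proof.
rewrite -(ler_pXn2r (n:=2)) ?nnegrE ?normc_ge0 ?addr_ge0 // normc_sqr.
rewrite sqrrD !real_normK ?num_real //.
by have := mulr_ge0 (normr_ge0 (complex.Re z)) (normr_ge0 (complex.Im z)); lra.
Qed.

Lemma pos_complexP (e : R[i]) : 0 < e -> exists2 r : R, 0 < r & e = r%:C.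
Proof.
by case: e => a b; rewrite ltcE /= => /andP[/eqP -> a0]; exists a.
Qed.

Lemma nbhs_complexP z (V : set C) :
  nbhs z V <-> exists2 e : R, 0 < e & forall w, nc (w - z) < e -> V w.
Proof.
split.
- move=> /nbhs_ballP [e /pos_complexP[r r0 ->] eV]; exists r => // w we.
  by apply: eV; rewrite -ball_normE /= distrC norm_normc ltcR.
- move=> [e e0 eV]; apply/nbhs_ballP; exists e%:C => /=; first by rewrite ltcR.
  by move=> w; rewrite -ball_normE /= distrC norm_normc ltcR; exact: eV.
Qed.

Lemma open_complexP (V : set C) :
  open V <->
  forall z, V z -> exists2 e : R, 0 < e & forall w, nc (w - z) < e -> V w.
Proof.
rewrite openE; split=> oV z Vz; first by apply/nbhs_complexP; exact: oV.
by apply/nbhs_complexP; exact: oV.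
Qed.

Lemma open_disc z (r : R) : open [set w : C | nc (w - z) < r].
Proof.
apply/open_complexP => w /= wz; exists (r - nc (w - z)); first by rewrite subr_gt0.
by move=> v vw; have := normc_dist w v z; lra.
Qed.

Lemma continuous_complexP (F : C -> C) z :
  {for z, continuous F} <->
  forall e : R, 0 < e -> exists2 d : R, 0 < d &
    forall w, nc (w - z) < d -> nc (F w - F z) < e.
Proof.
split=> [cF e e0|cF V].
  have : nbhs (F z) [set w | nc (w - F z) < e].
    by apply/nbhs_complexP; exists e.
  by move/cF => /nbhs_complexP.
move/nbhs_complexP => [e e0 eV]; apply/nbhs_complexP.
have [d d0 dP] := cF e e0; exists d => // w /dP; exact: eV.
Qed.

Lemma uniform_complexP (K : set C) (u : nat -> C -> C) (l : C -> C) :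
  {uniform K, u @ \oo --> l} <->
  forall e : R, 0 < e -> exists N, forall n, (N <= n)%N ->
    forall z, K z -> nc (u n z - l z) < e.
Proof.
split.
- move=> cu e e0.
  have := cu [set f | forall z, K z -> nc (f z - l z) < e]; case.
    apply/uniform_nbhs; exists [set zw | nc (zw.2 - zw.1) < e]; split=> //.
    rewrite -entourage_ballE /=; exists e%:C => /=; first by rewrite ltcR.
    by move=> [a b] /=; rewrite -ball_normE /= distrC norm_normc ltcR.
  by move=> N _ NP; exists N => n /NP.
- move=> cu P /uniform_nbhs [E [+ EP]].
  rewrite -entourage_ballE => -[e /= /pos_complexP[r r0 ->] eE].
  have [N NP] := cu _ r0; exists N => // n /NP nP; apply: EP => z /nP zz.
  by apply: eE => /=; rewrite -ball_normE /= distrC norm_normc ltcR.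
Qed.

Lemma continuous_mkcomplex : continuous (fun p : R * R => (p.1 +i* p.2 : C)).
Proof.
move=> [a b] V /nbhs_complexP [e e0 eV].
exists (ball a (e / 2), ball b (e / 2)) => /=.
  by split; apply: nbhsx_ballx; rewrite divr_gt0.
move=> [x y] /= []; rewrite -!ball_normE /= => xa yb; apply: eV.
apply: (le_lt_trans (normc_le_ReIm _)) => /=.
move: xa yb; rewrite (distrC a) (distrC b); lra.
Qed.

Lemma continuous_normcB z : continuous (fun w : C => nc (w - z)).
Proof.
move=> w V /nbhs_ballP [e /= e0 eV]; apply/nbhs_complexP; exists e => // v vw.
apply: eV; rewrite -ball_normE /=.
have := normc_dist v w z; have := normc_dist w v z; rewrite (normcB w v) => h1 h2.
by rewrite ltr_norml; apply/andP; split; lra.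
Qed.

(** The disc is a closed subset of a square, and the square is the continuous
    image of a product of two segments. *)
Lemma compact_disc z (r : R) : compact [set w : C | nc (w - z) <= r].
Proof.
case: z => c d; pose Q := [set (p.1 +i* p.2 : C) | p in
  (`[c - r, c + r] `*` `[d - r, d + r]) : set (R * R)].
have cQ : compact Q.
  apply: continuous_compact.
    exact/continuous_subspaceT/continuous_mkcomplex.
  by apply: compact_setX; exact: segment_compact.
apply: (subclosed_compact _ cQ).
  rewrite (_ : mkset _ = (fun w : C => nc (w - (c +i* d))) @^-1` [set x | x <= r]) //.
  apply: closed_comp; last exact: closed_le.
  by move=> w _; exact: continuous_normcB.
move=> [a b] /= ab; exists (a, b) => //=; rewrite !in_itv /=.
have /= h1 := normRe_le ((a +i* b) - (c +i* d)).
have /= h2 := normIm_le ((a +i* b) - (c +i* d)).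
have {h1} := le_trans h1 ab; have {h2} := le_trans h2 ab.
by rewrite !ler_norml => /andP[? ?] /andP[? ?]; split; apply/andP; split; lra.
Qed.

Lemma connected_disc z (r : R) : 0 < r ->
  connected [set w : C | nc (w - z) < r].
Proof.
move=> r0.
rewrite (_ : mkset _ = \bigcup_(w in [set w : C | nc (w - z) < r])
   [set (z + t%:C * (w - z) : C) | t in `[0, 1]%classic : set R]).
  apply: bigcup_connected.
    exists z => w _ /=; exists 0; first by rewrite in_itv /= lexx ler01.
    by rewrite mul0r addr0.
  move=> w _; apply: connected_continuous_connected; first exact: segment_connected.
  apply: continuous_subspaceT => t.
  move=> V /nbhs_complexP [e e0 eV].
  have k0 : 0 < nc (w - z) + 1 by have := normc_ge0 (w - z); lra.
  apply/nbhs_ballP; exists (e / (nc (w - z) + 1)); first exact: divr_gt0.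
  move=> s; rewrite -ball_normE /= distrC ltr_pdivlMr // => st; apply: eV.
  rewrite opprD addrACA subrr add0r -mulrBl Normc.normcM -rmorphB normc_real.
  by apply: le_lt_trans st; rewrite ler_wpM2l // lerDl.
apply/seteqP; split=> w /=.
  move=> wr; exists w => //; exists 1; first by rewrite /= in_itv /= lexx ler01.
  by rewrite mul1r addrC subrK.
move=> [v vr [t]]; rewrite /= in_itv /= => /andP[t0 t1] <-.
rewrite (addrC z) addrK Normc.normcM normc_real ger0_norm //.
by apply: le_lt_trans vr; rewrite ler_piMl // normc_ge0.
Qed.

End Modulus.

(** * Normality of iterates and attracting basins *)

Lemma exists_subsequence (P : nat -> nat -> Prop) :
  (forall i N, exists2 n, (N <= n)%N & P i n) ->
  exists s : nat -> nat, {homo s : m n / (m < n)%N} /\ forall i, P i (s i).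
Proof.
move=> PP.
have /choice[f fP] : forall p : nat * nat, exists n, (p.2 <= n)%N /\ P p.1 n.
  by move=> [i N]; have [n] := PP i N; exists n.
pose s := fix s i := if i is j.+1 then f (i, (s j).+1) else f (0%N, 0%N).
exists s; split=> [|[|i]].
- apply: homo_ltn; first exact: ltn_trans.
  by move=> i; have [/=] := fP (i.+1, (s i).+1).
- by have [] := fP (0%N, 0%N).
- by have [] := fP (i.+1, (s i).+1).
Qed.

Lemma increasing_ge_id (s : nat -> nat) :
  {homo s : m n / (m < n)%N} -> forall n, (n <= s n)%N.
Proof.
move=> hs; elim=> // n IH; exact: leq_ltn_trans IH (hs _ _ (ltnSn n)).
Qed.

(** A family of iterates is normal as soon as the sequence of all iterates
    converges, because every sequence of iteration numbers has a subsequence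
    of one of these two kinds. *)
Lemma constant_or_divergent_subsequence (m : nat -> nat) :
  exists s : nat -> nat, {homo s : i j / (i < j)%N} /\
    ((exists c, forall n, m (s n) = c) \/ forall n, (n <= m (s n))%N).
Proof.
have [[c cP]|nc] := pselect (exists c, forall N, exists2 n, (N <= n)%N & m n = c).
  have [s [hs sP]] := @exists_subsequence (fun _ n => m n = c) (fun _ => cP).
  by exists s; split=> //; left; exists c.
have mdiv c : exists N, forall n, (N <= n)%N -> (c <= m n)%N.
  elim: c => [|c [N NP]]; first by exists 0%N.
  have [N' N'P] : exists N', forall n, (N' <= n)%N -> m n <> c.
    apply: contra_notP nc => nc; exists c => N'.
    apply: contra_notP nc => nc; exists N' => n Nn mn; apply: nc; by exists n.
  exists (maxn N N') => n; rewrite geq_max => /andP[/NP cm /N'P/eqP mc].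
  by rewrite ltn_neqAle eq_sym mc.
have [|s [hs sP]] := @exists_subsequence (fun i n => (i <= m n)%N).
  move=> i N; have [N' N'P] := mdiv i.
  by exists (maxn N N'); [exact: leq_maxl|apply/N'P/leq_maxr].
by exists s; split=> //; right.
Qed.

Section Dynamics.
Variable R : realType.
Local Notation C := R[i]^o.
Local Notation nc := (@Normc.normc R).
Implicit Types (z w p : C) (F : C -> C) (V U : set C).

Lemma continuous_iter F n : continuous F -> continuous (iter n F : C -> C).
Proof.
move=> cF; elim: n => [|n IH] z; first exact: cvg_id.
by apply: (@continuous_comp _ _ _ (iter n F) F); [exact: IH|exact: cF].
Qed.

Lemma normal_iterates_cvg V F (l : C -> C) :
  (forall e : R, 0 < e -> exists N, forall n, (N <= n)%N ->
     forall z, V z -> nc (iter n F z - l z) < e) ->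
  normal_family V (range (fun n => iter n F)).
Proof.
move=> cl u uF.
have /choice[m mP] : forall n, exists k, u n = iter k F.
  by move=> n; have [k _ <-] := uF n; exists k.
have [s [hs [[c sc]|sd]]] := constant_or_divergent_subsequence m;
  exists s; split=> //; left.
  exists (iter c F) => K _ _; apply/uniform_complexP => e e0; exists 0%N => n _ z _.
  by rewrite /= mP sc subrr Normc.normc0.
exists l => K _ KV; apply/uniform_complexP => e /cl[N NP]; exists N => n Nn z /KV Vz.
by rewrite /= mP; apply: NP => //; exact: leq_trans Nn (sd n).
Qed.

Lemma normal_iterates_infty V F :
  (forall M : R, exists N, forall n, (N <= n)%N ->
     forall z, V z -> M <= nc (iter n F z)) ->
  normal_family V (range (fun n => iter n F)).
Proof.
move=> cl u uF.
have /choice[m mP] : forall n, exists k, u n = iter k F.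
  by move=> n; have [k _ <-] := uF n; exists k.
have [s [hs [[c sc]|sd]]] := constant_or_divergent_subsequence m;
  exists s; split=> //; [left|right].
  exists (iter c F) => K _ _; apply/uniform_complexP => e e0; exists 0%N => n _ z _.
  by rewrite /= mP sc subrr Normc.normc0.
move=> K _ KV M; have [N NP] := cl M; exists N => // n /= Nn z /KV Vz.
by rewrite norm_normc lecR mP; apply: NP => //; exact: leq_trans Nn (sd n).
Qed.

(** One subsequence of the iterates would have to do both: the escaping point
    excludes a finite limit and the bounded orbit excludes the limit infinity.
    Evaluation at two points suffices, as singletons are compact. *)
Lemma not_normal_bounded_escaping V F z w (B : R) :
  V z -> (forall M : R, exists N, forall n, (N <= n)%N -> M <= nc (iter n F z)) ->
  V w -> (exists N, forall n, (N <= n)%N -> nc (iter n F w) <= B) ->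
  ~ normal_family V (range (fun n => iter n F)).
Proof.
move=> Vz zinf Vw [N0 wB] /(_ (fun n => iter n F)) []; first by move=> n; exists n.
move=> s [hs [[l cl]|cinf]].
- have /uniform_complexP/(_ 1 ltr01)[N NP] :
      {uniform [set z], (fun n => iter n F) \o s @ \oo --> l}.
    by apply: cl; [exact: compact_set1|move=> _ ->].
  have [N' N'P] := zinf (nc (l z) + 1).
  have /NP/(_ z erefl) /= := leq_maxl N N'.
  have /N'P : (N' <= s (maxn N N'))%N.
    by apply: leq_trans _ (increasing_ge_id hs _); exact: leq_maxr.
  have := normc_triangle (iter (s (maxn N N')) F z - l z) (l z).
  rewrite subrK; lra.
- have [|N _ NP] := cinf [set w] (@compact_set1 _ w) _ (B + 1).
    by move=> _ ->.
  have /NP/(_ w erefl) := leq_maxl N N0; rewrite norm_normc lecR /=.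
  have /wB : (N0 <= s (maxn N N0))%N.
    by apply: leq_trans _ (increasing_ge_id hs _); exact: leq_maxr.
  lra.
Qed.

(** Whatever [component_iter] returns is either the default value or a component
    that contains the [k]-th iterate of [z0], and hence the component of that
    point; in both cases disjointness follows from the hypothesis. *)
Lemma wandering_component F z0 : Fatou F z0 ->
  (forall k l, k <> l ->
     ~ connected_component (Fatou F) (iter k F z0) (iter l F z0)) ->
  wandering F (connected_component (Fatou F) z0).
Proof.
move=> Fz0 sep; split; first by exists z0.
have comp k : component_iter F (connected_component (Fatou F) z0) k = set0 \/
    component_iter F (connected_component (Fatou F) z0) k =
    connected_component (Fatou F) (iter k F z0).
  rewrite /component_iter; case: xgetP => [V -> [[v Fv ->] sub]|_]; [right|by left].
  apply: same_connected_component; apply: sub; exists z0 => //.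
  exact: connected_component_refl.
move=> k l kl; have [->|->] := comp k; first by rewrite set0I.
have [->|->] := comp l; first by rewrite setI0.
apply: contra_notP (sep _ _ kl) => /eqP/set0P [x [xk xl]].
exact: connected_component_trans xk (connected_component_sym xl).
Qed.

Section Basin.
Variables (F : C -> C) (p : C) (r : R).
Hypothesis contF : continuous F.
Hypothesis r0 : 0 < r.
Hypothesis attrF : forall w, nc (w - p) < r -> nc (F w - p) <= nc (w - p) / 2.

Definition basin : set C := [set z | exists n, nc (iter n F z - p) < r].

Lemma iter_attracted w n : nc (w - p) < r -> nc (iter n F w - p) <= r / 2 ^+ n.
Proof.
move=> wr; elim: n => [|n IH]; first by rewrite divr1 ltW.
have : nc (iter n F w - p) < r.
  case: n IH => // n IH; apply: (le_lt_trans IH).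
  by rewrite ltr_pdivrMr ?exprn_gt0 // ltr_pMr // exprn_egt1 // ltr1n.
move/attrF => /= h; apply: (le_trans h).
by rewrite exprS invfM mulrCA mulrC ler_wpM2l ?invr_ge0.
Qed.

Lemma iter_attracted_lt (e : R) : 0 < e -> exists N, forall n, (N <= n)%N ->
  forall w, nc (w - p) < r -> nc (iter n F w - p) < e.
Proof.
move=> e0; exists (Num.truncn (r / e)).+1 => n Nn w /(iter_attracted n) h.
apply: (le_lt_trans h); rewrite ltr_pdivrMr ?exprn_gt0 // -ltr_pdivrMl // mulrC.
apply: (lt_le_trans (truncnS_gt _)); rewrite -natrX ler_nat.
by apply: leq_trans Nn _; exact: ltnW (ltn_expl _ _).
Qed.

Lemma basin_cvg z : basin z ->
  forall e : R, 0 < e -> exists N, forall n, (N <= n)%N -> nc (iter n F z - p) < e.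
Proof.
move=> [m zm] e /iter_attracted_lt[N NP]; exists (N + m)%N => n Nmn.
rewrite -(subnK (leq_trans (leq_addl _ _) Nmn)) iterD; apply: NP => //.
by rewrite leq_subRL ?(leq_trans (leq_addl _ _) Nmn) // addnC.
Qed.

Lemma open_basin : open basin.
Proof.
rewrite (_ : basin = \bigcup_(n in setT) (iter n F @^-1` [set w | nc (w - p) < r])).
  apply: bigcup_open => n _; apply: open_comp; last exact: open_disc.
  by move=> z _; exact: continuous_iter.
by apply/seteqP; split=> z [n]; exists n.
Qed.

Lemma basin_Fatou : basin `<=` Fatou F.
Proof.
move=> z [m zm]; exists (iter m F @^-1` [set w | nc (w - p) < r]); split=> //.
  apply: open_comp; last exact: open_disc.
  by move=> w _; exact: continuous_iter.
apply: (@normal_iterates_cvg _ _ (fun=> p)) => e /iter_attracted_lt[N NP].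
exists (N + m)%N => n Nmn w wm.
rewrite -(subnK (leq_trans (leq_addl _ _) Nmn)) iterD; apply: NP => //.
by rewrite leq_subRL ?(leq_trans (leq_addl _ _) Nmn) // addnC.
Qed.

Lemma iter_basin z k : basin z -> basin (iter k F z).
Proof.
move=> /basin_cvg/(_ _ r0)[N NP]; exists N; rewrite -iterD.
by apply: NP; exact: leq_addr.
Qed.

(** At a boundary point of the basin lying in the Fatou set, some subsequence
    of the iterates converges uniformly near the point.  The limit is not infinity
    and is the constant [p] on the basin, because nearby points of the basin are
    attracted to [p].  So near the point a single late iterate is uniformly
    close to [p] on the basin, hence by continuity also at the point itself,
    whose orbit thus enters the attracting disc. *)
Lemma Fatou_closure_basin z : Fatou F z -> closure basin z -> basin z.
Proof.
move=> [V [oV Vz nV]] clz.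
have [s [hs cs]] := nV (fun n => iter n F) (fun n => ex_intro2 _ _ n I erefl).
have /open_complexP/(_ _ Vz)[e e0 eV] := oV.
have basin_near d : 0 < d -> exists2 w, basin w & nc (w - z) < d.
  move=> d0; have /clz[w [Bw wd]] : nbhs z [set w | nc (w - z) < d].
    by apply/nbhs_complexP; exists d.
  by exists w.
have e20 : 0 < e / 2 by rewrite divr_gt0.
have KV : [set w : C | nc (w - z) <= e / 2] `<=` V.
  by move=> w /= we; apply: eV; lra.
case: cs => [[l cl]|cinf].
- have r40 : 0 < r / 4 by rewrite divr_gt0.
  have cK := cl _ (@compact_disc _ z (e / 2)) KV.
  have /uniform_complexP/(_ _ r40)[N NP] := cK.
  have /continuous_complexP/(_ _ r40)[d d0 dP] := @continuous_iter F (s N) contF z.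
  have [|w Bw wd] := basin_near (Num.min d (e / 2)); first by rewrite lt_min d0.
  move: wd; rewrite lt_min => /andP[/dP wz we].
  have lw : nc (l w - p) <= 0.
    apply/ler_addgt0Pr => t t0; rewrite add0r.
    have t20 : 0 < t / 2 by rewrite divr_gt0.
    have /uniform_complexP/(_ _ t20)[N1 N1P] := cK.
    have [N2 N2P] := basin_cvg Bw t20.
    have /N1P/(_ w (ltW we)) /= := leq_maxl N1 N2.
    have /N2P : (N2 <= s (maxn N1 N2))%N.
      by apply: leq_trans _ (increasing_ge_id hs _); exact: leq_maxr.
    have := normc_dist (iter (s (maxn N1 N2)) F w) (l w) p.
    rewrite (normcB (l w) (iter _ _ _)); lra.
  exists (s N).
  have := NP N (leqnn N) w (ltW we); rewrite /= => h.
  have := normc_dist (iter (s N) F w) (iter (s N) F z) p.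
  rewrite (normcB (iter _ _ z) (iter _ _ w)).
  have := normc_dist (l w) (iter (s N) F w) p; lra.
- have [w Bw we] := basin_near _ e20.
  have [|N _ NP] := cinf [set w] (@compact_set1 _ w) _ (nc p + 2).
    by move=> _ ->; apply: KV; exact: ltW.
  have [N2 N2P] := basin_cvg Bw ltr01.
  have /NP/(_ w erefl) := leq_maxl N N2; rewrite norm_normc lecR /=.
  have /N2P : (N2 <= s (maxn N N2))%N.
    by apply: leq_trans _ (increasing_ge_id hs _); exact: leq_maxr.
  have := normc_triangle (iter (s (maxn N N2)) F w - p) p; rewrite subrK; lra.
Qed.

(** By the previous lemma the basin is both open and closed in the Fatou set. *)
Lemma component_sub_basin z : basin z -> connected_component (Fatou F) z `<=` basin.
Proof.
move=> Bz w [A [Az AF cA] Aw].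
suff AB : A `&` basin = A by move: Aw; rewrite -AB => -[].
apply: cA.
- by exists z; split.
- by exists basin => //; exact: open_basin.
- exists (closure basin); first exact: closed_closure.
  apply/seteqP; split=> v [Av Bv]; split=> //; first exact: subset_closure.
  by apply: Fatou_closure_basin => //; exact: AF.
Qed.

(** The basin is forward invariant and contained in the Fatou set; this is what
    shows that the image of the component stays in the Fatou set, and so in a
    single component of it. *)
Lemma component_iter_basin z k : basin z ->
  component_iter F (connected_component (Fatou F) z) k =
  connected_component (Fatou F) (iter k F z).
Proof.
move=> Bz; have Fz := basin_Fatou Bz; apply: xget_unique.
- split; first by exists (iter k F z) => //; exact/basin_Fatou/iter_basin.
  apply: connected_component_max.
  + by exists z => //; exact: connected_component_refl.
  + move=> _ [w /(component_sub_basin Bz) Bw <-]; exact/basin_Fatou/iter_basin.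
  + apply: connected_continuous_connected; first exact: component_connected.
    exact/continuous_subspaceT/continuous_iter.
- move=> _ [[v Fv ->] sub]; apply: same_connected_component; apply: sub.
  by exists z => //; exact: connected_component_refl.
Qed.

Lemma attracting_fixed : F p = p.
Proof.
apply/eqP; rewrite -subr_eq0; apply/eqP/Normc.eq0_normc/eqP.
have := @attrF p; rewrite subrr Normc.normc0 mul0r => /(_ r0) h.
by rewrite eq_le h normc_ge0.
Qed.

Lemma basin_attractor : basin p.
Proof. by exists 0%N; rewrite subrr Normc.normc0. Qed.

Lemma attracting_component_periodic :
  periodic F (connected_component (Fatou F) p).
Proof.
split; first by exists p => //; exact/basin_Fatou/basin_attractor.
exists 1%N => //; rewrite component_iter_basin; last exact: basin_attractor.
by rewrite /iter attracting_fixed.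
Qed.

Lemma preperiodic_component z k : basin z -> iter k F z = p ->
  preperiodic F (connected_component (Fatou F) z).
Proof.
move=> Bz zk; split; first by exists z => //; exact: basin_Fatou.
have kk : k <> k.+1 by elim: k {zk} => // k IH [].
move=> [_ /(_ k k.+1 kk)]; rewrite !component_iter_basin // iterS zk.
rewrite attracting_fixed setIid; apply/eqP/set0P; exists p.
exact/connected_component_refl/basin_Fatou/basin_attractor.
Qed.

End Basin.
End Dynamics.

(** * The complex exponential *)

Section RealBounds.
Variable R : realType.
Implicit Types x y : R.

Lemma expR_quadratic x : `|x| <= 1 / 2 -> 0 <= expR x - 1 - x <= 2 * x ^+ 2.
Proof.
rewrite ler_norml => /andP[x1 x2].
have h1 := expR_ge1Dx x; have h2 := expR_ge1Dx (- x).
have h3 : expR x * (1 - x) <= 1.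
  by rewrite -[leRHS](expRxMexpNx_1 x) ler_wpM2l // expR_ge0.
apply/andP; split; first lra.
have h4 : (expR x - 1 - x) * (1 - x) <= x ^+ 2 by nra.
have h5 : 0 <= (expR x - 1 - x) * (1 / 2 - x) by apply: mulr_ge0; lra.
nra.
Qed.

Lemma abs_sin_le x : `|sin x| <= `|x|.
Proof.
wlog x0 : x / 0 < x => [hw|].
  have [/hw //|x0|<-] := ltrgtP 0 x; last by rewrite sin0.
  by rewrite -normrN -sinN -[leRHS]normrN; apply: hw; rewrite oppr_gt0.
have [c _] := @MVT_segment R sin cos 0 x (ltW x0)
  (fun y _ => is_derive_sin y) (continuous_subspaceT (@continuous_sin R)).
rewrite sin0 !subr0 => ->; rewrite normrM ler_piMl //; exact: cos_max.
Qed.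

Lemma abs_cos_sub1_le x : `|cos x - 1| <= x ^+ 2.
Proof.
wlog x0 : x / 0 < x => [hw|].
  have [/hw //|x0|<-] := ltrgtP 0 x; last by rewrite cos0 subrr normr0 sqr_ge0.
  by rewrite -cosN -sqrrN; apply: hw; rewrite oppr_gt0.
have [c] := @MVT_segment R cos (- sin) 0 x (ltW x0)
  (fun y _ => is_derive_cos y) (continuous_subspaceT (@continuous_cos R)).
rewrite in_itv /= cos0 subr0 => /andP[c0 cx] ->.
rewrite normrM normrN (gtr0_norm x0) expr2 ler_wpM2r ?(ltW x0) //.
by apply: (le_trans (abs_sin_le _)); rewrite ger0_norm.
Qed.

Lemma abs_sin_sub_le x : `|x| <= 1 -> `|sin x - x| <= x ^+ 2.
Proof.
wlog x0 : x / 0 < x => [hw|].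
  have [/hw //|x0|<-] := ltrgtP 0 x; last by rewrite sin0 subrr normr0 sqr_ge0.
  have := hw (- x); rewrite oppr_gt0 x0 normrN sqrrN sinN.
  by rewrite (_ : - sin x - - x = - (sin x - x)) ?normrN; [exact|ring].
rewrite (gtr0_norm x0) => x1.
have dsin (y : R) : y \in `]0, x[ -> is_derive y 1 (sin - id) ((cos - cst 1) y).
  by move=> _; apply: is_deriveB.
have csin : {within `[0, x], continuous (sin - id : R -> R)}.
  apply: continuous_subspaceT => y.
  by apply: continuousB; [exact: continuous_sin|exact: cvg_id].
have [c] := MVT_segment (ltW x0) dsin csin.
rewrite in_itv /= !fctE sin0 !subr0 => /andP[c0 cx] ->.
rewrite normrM (gtr0_norm x0) expr2 ler_wpM2r ?(ltW x0) //.
apply: (le_trans (abs_cos_sub1_le _)); nra.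
Qed.

End RealBounds.

Section ComplexExp.
Variable R : realType.
Local Notation C := R[i]^o.
Local Notation nc := (@Normc.normc R).
Implicit Types (z w : C) (x y : R).

Definition cexp z : C :=
  (expR (complex.Re z) * cos (complex.Im z)) +i* (expR (complex.Re z) * sin (complex.Im z)).

Lemma cexpD z w : cexp (z + w) = cexp z * cexp w.
Proof.
case: z w => [a b] [c d]; rewrite /cexp /= expRD cosD sinD.
by apply/eqP; rewrite eq_complex /=; apply/andP; split; apply/eqP; ring.
Qed.

Lemma cexp0 : cexp 0 = 1.
Proof. by rewrite /cexp /= expR0 cos0 sin0 !mul1r. Qed.

Lemma normc_cexp z : nc (cexp z) = expR (complex.Re z).
Proof.
rewrite /= !exprMn -mulrDr cos2Dsin2 mulr1 sqrtr_sqr ger0_norm //; exact: expR_ge0.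
Qed.

Lemma cexp_neq0 z : cexp z != 0.
Proof.
apply/eqP => /(congr1 nc); rewrite normc_cexp Normc.normc0 => /eqP.
by rewrite expR_eq0.
Qed.

Lemma cexp_real x : cexp x%:C = (expR x)%:C.
Proof. by rewrite /cexp /= cos0 sin0 mulr0 mulr1. Qed.

Definition I2pi (k : int) : C := 0 +i* (k%:~R * (pi *+ 2)).

Lemma I2piD k l : I2pi (k + l) = I2pi k + I2pi l.
Proof. by apply/eqP; rewrite eq_complex /= addr0 intrD mulrDl !eqxx. Qed.

Lemma I2pi0 : I2pi 0 = 0.
Proof. by rewrite /I2pi mul0r. Qed.

Lemma cexp_I2pi k : cexp (I2pi k) = 1.
Proof.
have pos (n : nat) : cexp (I2pi n) = 1.
  elim: n => [|n IH]; first by rewrite I2pi0 cexp0.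
  rewrite -addn1 PoszD I2piD cexpD IH mul1r /cexp /= mul1r expR0 cos2pi sin2pi.
  by rewrite mulr1 mulr0.
case: k => n; first exact: pos.
apply: (mulIf (cexp_neq0 (I2pi n.+1))).
by rewrite -cexpD -I2piD NegzE addNr I2pi0 cexp0 pos mulr1.
Qed.

Lemma cexpD_I2pi z k : cexp (z + I2pi k) = cexp z.
Proof. by rewrite cexpD cexp_I2pi mulr1. Qed.

Lemma cexp_surj w : w != 0 -> exists z, cexp z = w.
Proof.
move=> w0; have n0 : 0 < nc w.
  by rewrite lt_def normc_ge0 andbT; apply: contra_neq w0 => /Normc.eq0_normc.
suff : exists y, cos y = complex.Re w / nc w /\ sin y = complex.Im w / nc w.
  move=> [y [cy sy]]; exists (ln (nc w) +i* y).
  rewrite /cexp /= lnK ?posrE // cy sy.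
  by rewrite !(mulrCA (nc w)) divff ?gt_eqF // !mulr1; case: w {w0 n0 cy sy}.
have sq := normc_sqr w.
have c1 : -1 <= complex.Re w / nc w <= 1.
  rewrite ler_pdivlMr // ler_pdivrMr // mulN1r mul1r -ler_norml; exact: normRe_le.
have s1 : Num.sqrt (1 - (complex.Re w / nc w) ^+ 2) = `|complex.Im w / nc w|.
  rewrite -sqrtr_sqr; congr Num.sqrt; rewrite !expr_div_n.
  rewrite -[1](@divff _ (nc w ^+ 2)) ?expf_eq0 ?gt_eqF // -mulrBl sq.
  by rewrite addrAC subrr add0r.
have [b0|b0] := leP 0 (complex.Im w).
  exists (acos (complex.Re w / nc w)); rewrite acosK ?in_itv // sin_acos // s1.
  by rewrite ger0_norm // divr_ge0 // ltW.
exists (- acos (complex.Re w / nc w)); rewrite cosN sinN acosK ?in_itv // sin_acos // s1.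
by rewrite ltr0_norm ?opprK // pmulr_llt0 // invr_gt0.
Qed.

(** For [w = x + iy] the error splits as
    [(e^x - 1 - x) e^(iy) + (1 + x) (e^(iy) - 1 - iy) + i x y], each term of
    which is quadratic. *)
Lemma cexp_quadratic w : nc w <= 1 / 8 -> nc (cexp w - 1 - w) <= 4 * nc w ^+ 2.
Proof.
move=> w8.
have xw := le_trans (normRe_le w) w8; have yw := le_trans (normIm_le w) w8.
have sq := normc_sqr w.
apply: (le_trans (normc_le_ReIm _)); rewrite sq {sq w8}.
case: w xw yw => x y /= xw yw; rewrite oppr0 addr0.
have /expR_quadratic/andP[h1 h2] : `|x| <= 1 / 2 by lra.
have hs : `|sin y - y| <= y ^+ 2 by apply: abs_sin_sub_le; lra.
have hc := abs_cos_sub1_le y.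
have hs8 := le_trans (abs_sin_le y) yw.
have hc1 := cos_max y.
rewrite (_ : _ - 1 - x = (expR x - 1 - x) * cos y + (1 + x) * (cos y - 1)); last by ring.
rewrite (_ : _ - y = (expR x - 1 - x) * sin y + (1 + x) * (sin y - y) + x * y);
  last by ring.
set E := expR x - 1 - x in h1 h2 *.
move: xw yw; rewrite !ler_norml => /andP[x1 x2] /andP[y1 y2].
have xp : 0 <= 1 + x by lra.
have e1 : `|E * cos y + (1 + x) * (cos y - 1)| <= 2 * x ^+ 2 + 9 / 8 * y ^+ 2.
  apply: (le_trans (ler_normD _ _)); rewrite !normrM (ger0_norm h1) (ger0_norm xp).
  apply: lerD; first nra.
  have := normr_ge0 (cos y - 1); nra.
have e2 : `|E * sin y + (1 + x) * (sin y - y) + x * y| <=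
    x ^+ 2 / 4 + 9 / 8 * y ^+ 2 + (x ^+ 2 + y ^+ 2) / 2.
  apply: (le_trans (ler_normD _ _)); apply: lerD.
    apply: (le_trans (ler_normD _ _)); rewrite !normrM (ger0_norm h1) (ger0_norm xp).
    apply: lerD; first nra.
    have := normr_ge0 (sin y - y); nra.
  have := sqr_ge0 (x + y); have := sqr_ge0 (x - y).
  by rewrite ler_norml sqrrB sqrrD => p1 p2; apply/andP; split; lra.
have := lerD e1 e2; have := sqr_ge0 x; have := sqr_ge0 y; lra.
Qed.

End ComplexExp.

(** * A covering lemma *)

Section Covering.
Variable R : realType.
Local Notation C := R[i]^o.
Local Notation nc := (@Normc.normc R).
Implicit Types (z w a : C) (F : C -> C).

(** Complex differentiability at [z], with derivative [c] and an explicit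
    second order error, which makes step sizes in the covering lemma explicit.  The
    radius [1/8] is one on which [e^w - 1] is within [|w|/2] of [w]. *)
Definition quad_approx F z (c : C) :=
  exists M : R, forall w, nc w <= 1 / 8 ->
    nc (F (z + w) - F z - c * w) <= M * nc w ^+ 2.

Lemma quad_approx_derivable F z c : quad_approx F z c -> derivable F z 1.
Proof.
move=> [M MP]; apply/cvg_ex; exists c => V /nbhs_complexP [e e0 eV].
have M0 : 0 < `|M| + 1 by have := normr_ge0 M; lra.
suff : nbhs (0 : C) [set w : C | w != 0 -> V (w^-1 *: ((F \o shift z) (w *: 1) - F z))].
  by move=> h; rewrite /= /dnbhs /within /=; exact: h.
apply/nbhs_complexP; exists (Num.min (1 / 8) (e / (`|M| + 1))).
  by rewrite lt_min !divr_gt0.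
move=> w; rewrite subr0 lt_min => /andP[/ltW/MP w8]; rewrite ltr_pdivlMr // => we w0.
apply: eV => /=; rewrite -[w *: 1]/(w * 1) mulr1 addrC (addrC w).
have nw0 : 0 < nc w.
  by rewrite lt_def normc_ge0 andbT; apply: contra_neq w0 => /Normc.eq0_normc.
rewrite -[_ *: _]/(_ * _) (_ : - c + _ = w^-1 * (F (z + w) - F z - c * w)); last first.
  by field.
rewrite Normc.normcM Normc.normcV mulrC ltr_pdivrMr //.
apply: (le_lt_trans w8); rewrite expr2 mulrA ltr_pM2r //.
by apply: le_lt_trans we; rewrite mulrC ler_pM2l //; have := ler_norm M; lra.
Qed.

Lemma derivable_continuous F z : derivable F z 1 -> {for z, continuous F}.
Proof. by move=> /derivable1_diffP; exact: differentiable_continuous. Qed.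

Lemma small_scaling (X s : R) : 0 <= X -> 0 < s ->
  exists t : R, [/\ 0 < t, t <= 1 & t * X < s].
Proof.
move=> X0 s0; exists (s / (s + X + 1)); have k0 : 0 < s + X + 1 by lra.
split; first exact: divr_gt0.
  by rewrite ler_pdivrMr //; lra.
by rewrite mulrAC ltr_pdivrMr // ltr_pM2l //; lra.
Qed.

(** Minimise [|F z - v|] over the compact disc.  A minimum on the boundary would
    exceed the value at the centre.  At an interior minimum with [F z <> v], a
    small step along [- (F z - v) / F'(z)] would decrease the distance further,
    since the derivative is nonzero.  Hence the minimum is [0]. *)
Lemma covering F a (rho m : R) : 0 < rho -> continuous F ->
  (forall z, nc (z - a) <= rho -> exists2 c : C, c != 0 & quad_approx F z c) ->
  (forall z, nc (z - a) = rho -> m <= nc (F z - F a)) ->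
  forall v : C, nc (v - F a) < m / 2 -> exists2 z, nc (z - a) <= rho & F z = v.
Proof.
move=> rho0 cF dF bF v va.
have aD : [set w : C | nc (w - a) <= rho] a by rewrite /= subrr Normc.normc0 ltW.
have [|z] := @compact_EVT_min _ R (fun w => nc (F w - v)) _ (ex_intro _ a aD)
    (compact_disc (z := a) (r := rho)).
  apply: continuous_subspaceT => w.
  apply: (@continuous_comp _ _ _ F (fun y : C => nc (y - v))); first exact: cF.
  exact: continuous_normcB.
rewrite inE /= => za zmin; exists z => //; apply/eqP; rewrite -subr_eq0.
apply/negP => /negP D0.
have za' : nc (z - a) < rho.
  rewrite lt_neqAle za andbT; apply/eqP => /bF h.
  have := zmin a; rewrite inE => /(_ aD).
  have := normc_dist v (F z) (F a); rewrite (normcB (F a) v); lra.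
have [c c0 [M MP]] := dF z za.
pose D := F z - v; pose A := nc D / nc c.
have nD : 0 < nc D.
  by rewrite lt_def normc_ge0 andbT; apply: contra_neq D0 => /Normc.eq0_normc.
have nc0 : 0 < nc c.
  by rewrite lt_def normc_ge0 andbT; apply: contra_neq c0 => /Normc.eq0_normc.
have A0 : 0 < A by exact: divr_gt0.
pose K := `|M| * A / nc c.
have K0 : 0 <= K.
  by apply: divr_ge0; [apply: mulr_ge0; [exact: normr_ge0|exact: ltW]|exact: ltW].
have KE : `|M| * A = K * nc c by rewrite /K divfK // gt_eqF.
have DE : nc D = A * nc c by rewrite /A divfK // gt_eqF.
(* The bound on [t * A] keeps the step inside the disc and inside the range of
   the quadratic approximation; the bound on [t * K] makes the quadratic error
   smaller than the first order gain [t * nc D]. *)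
have [||t [t0 t1]] :=
    @small_scaling (A + K) (Num.min (1 / 8) (rho - nc (z - a))).
- lra.
- by rewrite lt_min subr_gt0 za' andbT.
rewrite lt_min => /andP[t8 tg].
have tA : t * A <= t * (A + K) by rewrite ler_pM2l //; lra.
have tM : t * K <= t * (A + K) by rewrite ler_pM2l //; lra.
pose w : C := - (t%:C * D / c).
have nw : nc w = t * A.
  by rewrite normcN Normc.normcM Normc.normcM Normc.normcV normc_real gtr0_norm // mulrA.
have /MP : nc w <= 1 / 8 by rewrite nw; lra.
rewrite (_ : _ - c * w = F (z + w) - v - (1 - t)%:C * D); last first.
  rewrite /w mulrN opprK (mulrCA c) divff // mulr1 rmorphB rmorph1 /D.
  by rewrite mulrBl mul1r; ring.
rewrite nw => h.
have : nc (F z - v) <= nc (F (z + w) - v).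
  apply: zmin; rewrite inE /=; apply: le_trans (normc_dist z _ _) _.
  by rewrite addrAC subrr add0r nw; lra.
apply/negP; rewrite -ltNge -/D.
have := le_normcD (F (z + w) - v - (1 - t)%:C * D) ((1 - t)%:C * D).
rewrite subrK Normc.normcM normc_real ger0_norm ?subr_ge0 // => h2.
have h3 : M * (t * A) ^+ 2 < t * nc D.
  apply: (@le_lt_trans _ _ (`|M| * (t * A) ^+ 2)).
    by rewrite ler_wpM2r ?sqr_ge0 // ler_norm.
  rewrite (_ : `|M| * (t * A) ^+ 2 = t * A * t * (`|M| * A)); last by ring.
  rewrite KE DE (_ : _ * (K * _) = (t * K) * (t * (A * nc c))); last by ring.
  rewrite gtr_pMl; first lra.
  by apply: mulr_gt0 => //; exact: mulr_gt0.
lra.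
Qed.

End Covering.

(** * The maps and the lines outside the Fatou set *)

Section Functions.
Variable R : realType.
Local Notation C := R[i]^o.
Local Notation nc := (@Normc.normc R).
Local Notation cexp := (@cexp R).
Local Notation I2pi := (@I2pi R).
Implicit Types (z w a : C) (F : C -> C).

Definition expaff (al be ga : C) z : C := al * z + be * cexp z + ga.

Lemma expaffD al be ga z w :
  expaff al be ga (z + w) - expaff al be ga z = al * w + be * cexp z * (cexp w - 1).
Proof. by rewrite /expaff cexpD; ring. Qed.

Lemma expaff_quad_approx al be ga z :
  quad_approx (expaff al be ga) z (al + be * cexp z).
Proof.
exists (4 * nc (be * cexp z)) => w /cexp_quadratic w8; rewrite expaffD.
rewrite (_ : _ - _ = be * cexp z * (cexp w - 1 - w)); last by ring.
by rewrite Normc.normcM mulrAC [leRHS]mulrC ler_wpM2l // normc_ge0.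
Qed.

Lemma expaff_continuous al be ga : continuous (expaff al be ga).
Proof.
by move=> z; exact/derivable_continuous/quad_approx_derivable/expaff_quad_approx.
Qed.

Lemma I2pi_inj : injective (fun n : nat => I2pi n).
Proof.
move=> m n [h]; apply/eqP; rewrite -(eqr_nat R); apply/eqP.
by apply: (mulIf _ h); rewrite gt_eqF // pmulrn_lgt0 // pi_gt0.
Qed.

(** Otherwise [e^z - 1] would be a polynomial, but it has infinitely many zeros. *)
Lemma expaff_transcendental al be ga :
  be != 0 -> transcendental_entire (expaff al be ga).
Proof.
move=> be0; split=> [z|[p pE]]; first exact/quad_approx_derivable/expaff_quad_approx.
pose q : {poly R[i]} := p - al *: 'X - (ga + be)%:P.
have qE z : q.[z] = be * (cexp z - 1).
  by rewrite !hornerE -pE /expaff; ring.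
have q0 : q = 0.
  apply/eqP/negP => /negP q0.
  pose rs := [seq (I2pi (Posz n) : R[i]) | n <- iota 0 (size q)].
  have rroot : all (root q) rs.
    by apply/allP => _ /mapP[n _ ->]; rewrite /root qE cexp_I2pi subrr mulr0.
  have runiq : uniq rs by rewrite map_inj_uniq ?iota_uniq //; exact: I2pi_inj.
  by have := max_poly_roots q0 rroot runiq; rewrite size_map size_iota ltnn.
have := qE (1 : R)%:C; rewrite q0 horner0 cexp_real => /esym/eqP.
rewrite mulf_eq0 (negbTE be0) subr_eq0 /= => /eqP [] /eqP.
by rewrite gt_eqF // expR_gt1.
Qed.

(** Newton's map for the function [e^(-z) - 1], whose zeros are the multiples of
    [2 pi i].  They are superattracting fixed points of the map. *)
Definition newton : C -> C := expaff 1 (-1) 1.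

(** Composed with the translation by [2 pi i], with which it commutes, Newton's
    map sends a neighbourhood of each zero into a neighbourhood of the next. *)
Definition wander : C -> C := expaff 1 (-1) (1 + I2pi 1).

(** Contracting near [0] and of period [2 pi i], this map brings the discs around
    all the zeros of [e^z - 1] back into the disc around [0]. *)
Definition attract : C -> C := expaff 0 (1 / 3)%:C (- (1 / 3)%:C).

Lemma newtonE z : newton z = z + 1 - cexp z.
Proof. by rewrite /newton /expaff; ring. Qed.

Lemma wanderE z : wander z = newton z + I2pi 1.
Proof. by rewrite /wander /newton /expaff; ring. Qed.

Lemma attractE z : attract z = (1 / 3)%:C * (cexp z - 1).
Proof. by rewrite /attract /expaff; ring. Qed.

Lemma newtonD_I2pi z k : newton (z + I2pi k) = newton z + I2pi k.
Proof. by rewrite !newtonE cexpD_I2pi; ring. Qed.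

Lemma attractD_I2pi z k : attract (z + I2pi k) = attract z.
Proof. by rewrite !attractE cexpD_I2pi. Qed.

Lemma iter_wander n z : iter n wander z = iter n newton z + I2pi n.
Proof.
elim: n => [|n IH]; first by rewrite I2pi0 addr0.
by rewrite !iterS IH wanderE newtonD_I2pi -addrA -I2piD -PoszD addn1.
Qed.

Lemma cexp_sub1_linear w : nc w <= 1 / 8 -> nc (cexp w - 1 - w) <= nc w / 2.
Proof.
move=> w8; apply: (le_trans (cexp_quadratic w8)).
by have := normc_ge0 w; nra.
Qed.

Lemma newton_contract w : nc w <= 1 / 8 -> nc (newton w) <= nc w / 2.
Proof.
move=> /cexp_sub1_linear; rewrite newtonE -normcN.
by rewrite (_ : - (cexp w - 1 - w) = w + 1 - cexp w); [|ring].
Qed.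

Lemma attract_contract w : nc w <= 1 / 8 -> nc (attract w) <= nc w / 2.
Proof.
move=> /cexp_sub1_linear h; rewrite attractE Normc.normcM normc_real.
rewrite ger0_norm; last lra.
have := normc_triangle (cexp w - 1 - w) w; rewrite subrK; lra.
Qed.

(** With [E = e^z], the map is [w - E (e^w - 1)] in the coordinate [w] centred at
    [z].  It differs from the linear map [(1 - E) w] by at most [|E| |w| / 2], and
    its derivative differs from [1 - E] by at most [|E| / 2].  So [c] is a lower
    bound for the modulus of the derivative and for the rate at which the map
    moves points away from the image of the centre. *)
Lemma newton_cover z (c rho : R) : 0 < rho -> rho <= 1 / 8 -> 0 < c ->
  c <= nc (1 - cexp z) - nc (cexp z) / 2 ->
  forall v, nc (v - newton z) < rho * c / 2 ->
    exists2 w, nc (w - z) <= rho & newton w = v.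
Proof.
move=> rho0 rho8 c0 cz; apply: covering => //; first exact: expaff_continuous.
- move=> w wz; exists (1 + -1 * cexp w); last exact: expaff_quad_approx.
  have w8 := le_trans wz rho8.
  apply/eqP => /(congr1 nc); rewrite Normc.normc0.
  rewrite (_ : 1 + _ = (1 - cexp z) + - (cexp z * (cexp (w - z) - 1))); last first.
    have -> : cexp w = cexp (w - z) * cexp z by rewrite -cexpD subrK.
    by ring.
  have := normc_triangleB (1 - cexp z) (- (cexp z * (cexp (w - z) - 1))).
  rewrite normcN Normc.normcM.
  have := cexp_sub1_linear w8.
  have := normc_triangle (cexp (w - z) - 1 - (w - z)) (w - z).
  rewrite subrK => h1 h2 h3 h4.
  have : nc (cexp z) * nc (cexp (w - z) - 1) <= nc (cexp z) / 2.
    by rewrite ler_wpM2l ?normc_ge0 //; lra.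
  lra.
- move=> w wz; have w8 : nc (w - z) <= 1 / 8 by rewrite wz.
  rewrite -{1}(subrK z w) (addrC _ z) expaffD.
  rewrite (_ : _ + _ = (1 - cexp z) * (w - z) +
    - (cexp z * (cexp (w - z) - 1 - (w - z)))); last by ring.
  have := normc_triangleB ((1 - cexp z) * (w - z))
    (- (cexp z * (cexp (w - z) - 1 - (w - z)))).
  rewrite normcN !Normc.normcM.
  have := ler_wpM2l (normc_ge0 (cexp z)) (cexp_sub1_linear w8).
  rewrite wz => h1 h2; apply: le_trans h2.
  have := ler_wpM2r (ltW rho0) cz; lra.
Qed.

(** Height of the [k]-th horizontal line separating the zeros [2 pi i k] and
    [2 pi i (k + 1)]. *)
Definition oddpi (k : nat) : R := (k.*2.+1)%:R * pi.

Lemma cexp_oddpi k (x : R) : cexp (x +i* oddpi k) = - (expR x)%:C.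
Proof.
have -> : (x +i* oddpi k : C) = x%:C + (0 +i* pi) + I2pi k.
  apply/eqP; rewrite eq_complex /= !addr0 add0r eqxx /= /oddpi -pmulrn; apply/eqP.
  by rewrite -mul2n -addn1 natrD natrM -(mulr_natl pi 2); ring.
rewrite cexpD_I2pi cexpD cexp_real /cexp /= expR0 cospi sinpi mulr0 mul1r.
by apply/eqP; rewrite eq_complex /=; apply/andP; split; apply/eqP; ring.
Qed.

(** Real part of the orbit under [newton] of a point of the line. *)
Definition line_orbit (x : R) n := iter n (fun t => t + 1 + expR t) x.

Lemma iter_newton_line k x n : iter n newton (x +i* oddpi k) = line_orbit x n +i* oddpi k.
Proof.
elim: n => // n IH; rewrite iterS IH newtonE cexp_oddpi.
apply/eqP; rewrite eq_complex /=; apply/andP.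
by split; apply/eqP; rewrite /line_orbit /=; ring.
Qed.

Lemma line_orbit_ge x n : x + n%:R <= line_orbit x n.
Proof.
elim: n => [|n IH]; first by rewrite addr0.
rewrite /line_orbit iterS -/(line_orbit x n) -natr1.
have := expR_gt0 (line_orbit x n); lra.
Qed.

(** The quotient [y_n = e^(x_n) / 2^n] satisfies [y_(n+1) >= y_n + y_n^2 / 2], by the
    inequality [1 + t <= e^t]. *)
Lemma expR_line_orbit_ge x n :
  expR x + n%:R * (expR x ^+ 2 / 2) <= expR (line_orbit x n) / 2 ^+ n.
Proof.
have b0 := expR_gt0 x.
elim: n => [|n IH]; first by rewrite mul0r addr0 divr1.
set y := expR (line_orbit x n) / 2 ^+ n in IH.
have y0 : expR x <= y.
  apply: le_trans IH; rewrite lerDl; apply: mulr_ge0; first exact: ler0n.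
  by have := sqr_ge0 (expR x); lra.
have ey : y <= expR (line_orbit x n).
  by rewrite ler_pdivrMr ?exprn_gt0 // ler_peMr ?expR_ge0 // exprn_ege1 // ler1n.
rewrite /line_orbit iterS -/(line_orbit x n) -addrA expRD (exprS 2 n).
rewrite (_ : expR _ * expR _ / _ = y * (expR (1 + expR (line_orbit x n)) / 2)); last first.
  by rewrite /y invfM; ring.
have h := expR_ge1Dx (1 + expR (line_orbit x n)).
have : y * (1 + y / 2) <= y * (expR (1 + expR (line_orbit x n)) / 2).
  by apply: ler_wpM2l; lra.
have : expR x ^+ 2 <= y ^+ 2 by rewrite lerXn2r // nnegrE; lra.
by rewrite -[n.+1%:R]natr1; lra.
Qed.

Lemma line_escapes k x (M : R) :
  exists N, forall n, (N <= n)%N -> M <= nc (iter n wander (x +i* oddpi k)).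
Proof.
exists (Num.truncn (`|M| + `|x|)).+1 => n Nn.
rewrite iter_wander iter_newton_line; apply: le_trans (normRe_le _); rewrite /= addr0.
apply: le_trans (ler_norm _); apply: le_trans (line_orbit_ge _ _).
have := truncnS_gt (`|M| + `|x|); rewrite -(ler_nat R) in Nn.
have := ler_norm M; have := ler_norm (- x); rewrite normrN; lra.
Qed.

(** On the line [E = - e^x] is negative, so [1 - E] has modulus [1 + e^x] and the
    map expands there by a factor that grows like [e^x]. *)
Lemma newton_cover_line k x (rho : R) v : 0 < rho -> rho <= 1 / 8 ->
  nc (v - newton (x +i* oddpi k)) < rho * (1 + expR x / 2) / 2 ->
  exists2 w, nc (w - (x +i* oddpi k)) <= rho & newton w = v.
Proof.
move=> rho0 rho8; have E0 := expR_gt0 x; apply: (@newton_cover _ (1 + expR x / 2)) => //.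
rewrite cexp_oddpi opprK normcN -(rmorph1 (real_complex R)) -rmorphD !normc_real.
by rewrite !ger0_norm; lra.
Qed.

Lemma newton_line k x n :
  newton (line_orbit x n +i* oddpi k) = line_orbit x n.+1 +i* oddpi k.
Proof. by rewrite -!iter_newton_line iterS iter_newton_line. Qed.

Lemma divr_expr2_le (rho : R) n : 0 <= rho -> rho / 2 ^+ n <= rho.
Proof.
move=> rho0; rewrite ler_pdivrMr ?exprn_gt0 // ler_peMr //.
by rewrite exprn_ege1 // ler1n.
Qed.

(** Halving the radius at each step is a crude bound, valid also where [e^x] is
    small. *)
Lemma line_cover_halving k x (V : set C) (rho : R) : 0 < rho -> rho <= 1 / 8 ->
  (forall w, nc (w - (x +i* oddpi k)) <= rho -> V w) ->
  forall n v, nc (v - (line_orbit x n +i* oddpi k)) <= rho / 2 ^+ n ->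
    exists2 w, V w & iter n newton w = v.
Proof.
move=> rho0 rho8 rV; elim=> [|n IH] v; first by rewrite divr1 => /rV Vv; exists v.
move=> hv; have r0 : 0 < rho / 2 ^+ n by rewrite divr_gt0 // exprn_gt0.
have r8 := le_trans (divr_expr2_le n (ltW rho0)) rho8.
have E0 := expR_gt0 (line_orbit x n).
have [|w /IH[u Vu hu] hw] := @newton_cover_line k (line_orbit x n) _ v r0 r8.
  rewrite newton_line; apply: le_lt_trans hv _.
  by rewrite exprSr invfM mulrA ltr_pM2r ?invr_gt0 // ltr_pMr //; lra.
by exists u => //; rewrite iterS hu.
Qed.

(** The expansion factor [e^(x_n)] at the last step outweighs the [n] halvings
    before it. *)
Lemma line_cover_large k x (V : set C) (rho K : R) : 0 < rho -> rho <= 1 / 8 ->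
  (forall w, nc (w - (x +i* oddpi k)) <= rho -> V w) ->
  exists n, K <= line_orbit x n /\
    forall v, nc (v - (line_orbit x n +i* oddpi k)) < 4 ->
      exists2 w, V w & iter n newton w = v.
Proof.
move=> rho0 rho8 rV; have b0 := expR_gt0 x.
have bb0 : 0 < expR x ^+ 2 / 2 by rewrite divr_gt0 // exprn_gt0.
pose n := maxn (Num.truncn (K + `|x|))
  (Num.truncn (16 / rho / (expR x ^+ 2 / 2))).
have n1 : K + `|x| <= n.+1%:R.
  by apply: le_trans (ltW (truncnS_gt _)) _; rewrite ler_nat ltnS leq_maxl.
have n2 : 16 / rho / (expR x ^+ 2 / 2) <= n.+1%:R.
  by apply: le_trans (ltW (truncnS_gt _)) _; rewrite ler_nat ltnS leq_maxr.
have nrho : 16 <= rho * (expR (line_orbit x n.+1) / 2 ^+ n.+1).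
  rewrite mulrC -ler_pdivrMr //; apply: le_trans (expR_line_orbit_ge _ _).
  by move: n2; rewrite ler_pdivrMr // => n2; lra.
exists n.+2; split.
  apply: le_trans (line_orbit_ge _ _); rewrite -[n.+2%:R]natr1.
  by have := ler_norm (- x); rewrite normrN; lra.
move=> v hv; have r0 : 0 < rho / 2 ^+ n.+1 by rewrite divr_gt0 // exprn_gt0.
have r8 := le_trans (divr_expr2_le n.+1 (ltW rho0)) rho8.
have [|w wz hw] := @newton_cover_line k (line_orbit x n.+1) _ v r0 r8.
  rewrite newton_line; apply: lt_le_trans hv _.
  have -> : rho / 2 ^+ n.+1 * (1 + expR (line_orbit x n.+1) / 2) / 2 =
      rho / 2 ^+ n.+1 / 2 + rho * (expR (line_orbit x n.+1) / 2 ^+ n.+1) / 4.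
    by field; rewrite expf_neq0.
  by have := ltW r0; lra.
have [u Vu hu] := line_cover_halving rho0 rho8 rV wz.
by exists u => //; rewrite iterS hu.
Qed.

(** At the point [z] at distance [pi / 2] below the line, the exponential is the
    imaginary number [i e^X].  Hence [newton z] has real part [X + 1], and a small disc
    around [z] covers a disc of radius comparable to [e^X] around [newton z]; this
    reaches the vertical line through [p] and there meets [p + 2 pi i Z]. *)
Lemma newton_meets_lattice k (p : C) : exists K : R, forall X, K <= X ->
  exists m, exists2 w, nc (w - (X +i* oddpi k)) < 4 & newton w = p + I2pi m.
Proof.
pose P := `|complex.Re p|; have P0 : 0 <= P by exact: normr_ge0.
(* A generous threshold past which the covered radius, nearly [e^X / 32], exceeds
   the horizontal distance [P + X + 1] plus the bound [8] on the vertical one. *)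
pose K := 400 + 8 * P; exists K => X nx.
pose z : C := X +i* (oddpi k - pi / 2).
have zE : cexp z = 0 +i* expR X.
  rewrite /z (_ : _ +i* _ = X +i* oddpi k + (0 +i* - (pi / 2))); last first.
    by apply/eqP; rewrite eq_complex /= addr0 !eqxx.
  rewrite cexpD cexp_oddpi /cexp /= expR0 cosN sinN cos_pihalf sin_pihalf.
  by apply/eqP; rewrite eq_complex /=; apply/andP; split; apply/eqP; ring.
have X0 : 0 <= X by rewrite /K in nx; lra.
have EXbig : X ^+ 2 / 2 + 1 <= expR X by have := expR_ge1Dxn 1 X0; rewrite addrC.
have EX64 : 3 * X + 25 * P + 400 <= X ^+ 2 / 64.
  have h1 : X * K <= X * X by apply: ler_wpM2l.
  have h2 : P * 400 <= P * X by apply: ler_wpM2l => //; rewrite /K in nx; lra.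
  by rewrite /K in nx h1; lra.
have nz : nc (cexp z) = expR X by rewrite normc_cexp.
(* The multiple of [2 pi] that brings the imaginary part of [p] closest to that of
   [newton z] from below. *)
pose T := oddpi k - pi / 2 - expR X - complex.Im p.
pose m := Num.floor (T / (pi *+ 2)).
have pi2 : 0 < pi *+ 2 :> R by rewrite pmulrn_lgt0 // pi_gt0.
have pi8 : pi *+ 2 <= 8 :> R by have := @pihalf_lt2 R; lra.
have [mT1 mT2] : m%:~R * (pi *+ 2) <= T /\ T < m%:~R * (pi *+ 2) + pi *+ 2.
  have m1 := @floor_le R (T / (pi *+ 2)); have m2 := @floorD1_gt R (T / (pi *+ 2)).
  rewrite ler_pdivlMr // in m1; rewrite ltr_pdivrMr // intrD mulrDl mul1r in m2.
  by split.
have [|||||w wz hw] :=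
    @newton_cover z (expR X / 2 - 1) (1 / 8) _ _ _ _ (p + I2pi m).
- lra.
- lra.
- lra.
- have := normc_triangle (1 - cexp z) (- 1).
  rewrite addrAC subrr add0r !normcN nz Normc.normc1; lra.
- apply: le_lt_trans (normc_le_ReIm _) _.
  have -> : p + I2pi m - newton z = (complex.Re p - (X + 1)) +i*
      (complex.Im p + m%:~R * (pi *+ 2) - (oddpi k - pi / 2 - expR X)).
    rewrite newtonE zE [in LHS](_ : p = complex.Re p +i* complex.Im p); last by case: (p).
    by apply/eqP; rewrite eq_complex /=; apply/andP; split; apply/eqP; ring.
  rewrite /=; have : `|complex.Re p - (X + 1)| <= P + X + 1.
    by apply: le_trans (ler_normB _ _) _; rewrite -/P ger0_norm; lra.
  have : `|complex.Im p + m%:~R * (pi *+ 2) - (oddpi k - pi / 2 - expR X)| <= 8.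
    by rewrite ler_norml; apply/andP; split; rewrite /T in mT1 mT2; lra.
  lra.
exists m, w => //; apply: le_lt_trans (normc_dist z _ _) _.
apply: le_lt_trans (_ : 1 / 8 + 2 < 4); last lra.
apply: lerD => //; apply: le_trans (normc_le_ReIm _) _ => /=.
rewrite subrr normr0 add0r addrAC subrr add0r normrN ger0_norm.
  by have := @pihalf_lt2 R; lra.
by have := @pi_gt0 R; lra.
Qed.

Lemma wander_fixed p m : cexp p = 1 + I2pi 1 -> wander (p + I2pi m) = p + I2pi m.
Proof.
move=> pE; rewrite wanderE newtonD_I2pi newtonE pE.
rewrite (_ : p + 1 - (1 + I2pi 1) = p - I2pi 1); last by ring.
by ring.
Qed.

(** The point of the line escapes under [wander], whereas arbitrarily close to it
    there are preimages of the fixed points of [wander], which form a lattice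
    [p + 2 pi i Z]. *)
Lemma line_not_Fatou k x : ~ Fatou wander (x +i* oddpi k).
Proof.
move=> [V [oV Vz nV]].
have [|p pE] := @cexp_surj R (1 + I2pi 1).
  by apply/eqP => -[] /eqP; rewrite addr0 oner_eq0.
have /open_complexP/(_ _ Vz)[e e0 eV] := oV.
pose rho := Num.min (1 / 8) (e / 2).
have rho0 : 0 < rho by rewrite lt_min !divr_gt0.
have rho8 : rho <= 1 / 8 by rewrite ge_min lexx.
have rhoV w : nc (w - (x +i* oddpi k)) <= rho -> V w.
  move=> wr; apply: eV; apply: le_lt_trans wr _.
  by rewrite gt_min; apply/orP; right; lra.
have [K KP] := newton_meets_lattice k p.
have [n [/KP[m [w wX hw]] big]] := line_cover_large K rho0 rho8 rhoV.
have [u Vu hu] := big w wX.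
have uE : iter n.+1 wander u = p + I2pi (m + n.+1).
  by rewrite iter_wander iterS hu hw -addrA -I2piD.
apply: (@not_normal_bounded_escaping _ V wander (x +i* oddpi k) u
  (nc (p + I2pi (m + n.+1)))) nV => //; first exact: line_escapes.
exists n.+1 => N Nn; rewrite -(subnK Nn) iterD uE.
rewrite (_ : iter _ _ (p + _) = p + I2pi (m + n.+1)) //.
by elim: (N - n.+1)%N => //= j ->; exact: wander_fixed.
Qed.

End Functions.

(** * The theorem *)

Section Main.
Variable R : realType.
Local Notation C := R[i]^o.
Local Notation nc := (@Normc.normc R).
Local Notation I2pi := (@I2pi R).
Local Notation f := (@attract R).
Local Notation g := (@wander R).
Local Notation h := (@newton R).

Lemma newton0 : h 0 = 0.
Proof. by rewrite newtonE cexp0; ring. Qed.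

Lemma attract0 : f 0 = 0.
Proof. by rewrite attractE cexp0; ring. Qed.

Lemma iter_wander0 k : iter k g 0 = I2pi k.
Proof.
rewrite iter_wander (_ : iter k h 0 = 0) ?add0r //.
by elim: k => //= k ->; exact: newton0.
Qed.

Definition trap : set C := [set w | nc w < 1 / 8].

Lemma trap0 : trap 0.
Proof. by rewrite /trap /mkset Normc.normc0. Qed.

Lemma domain_trap : domain trap.
Proof.
have DE : trap = [set w : C | nc (w - 0) < 1 / 8] by apply/funext => w /=; rewrite subr0.
split; first by exists 0; exact: trap0.
  by rewrite DE; exact: open_disc.
by rewrite DE; exact: connected_disc.
Qed.

Lemma trap_component (E : set C) : trap `<=` E -> trap `<=` connected_component E 0.
Proof.
by move=> DE; apply: connected_component_max => //; [exact: trap0|case: domain_trap].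
Qed.

Lemma wander_trap_Fatou : trap `<=` Fatou g.
Proof.
move=> z Dz; exists trap; split=> //; first by case: domain_trap.
apply: normal_iterates_infty => M; exists (Num.truncn (`|M| + 1)).+1 => n Nn w Dw.
have : nc (iter n h w) < 1 / 8.
  elim: n {Nn} => // n IH; rewrite iterS; apply: le_lt_trans (newton_contract (ltW IH)) _.
  by have := normc_ge0 (iter n h w); lra.
rewrite iter_wander addrC; have := normc_triangleB (I2pi n) (iter n h w).
have := normIm_le (I2pi n); rewrite /= -pmulrn ger0_norm; last first.
  by rewrite mulr_ge0 // pmulrn_lge0 // pi_ge0.
have : n%:R <= n%:R * (pi *+ 2) :> R by rewrite ler_peMr //; have := @pi_ge2 R; lra.
have := truncnS_gt (`|M| + 1); rewrite -(ler_nat R) in Nn; have := ler_norm M; lra.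
Qed.

(** A connected set containing [2 pi i k] and [2 pi i l] meets one of the horizontal
    lines that avoid the Fatou set, by the intermediate value theorem for the
    imaginary part. *)
Lemma wander_components_differ (k l : nat) : k <> l ->
  ~ connected_component (Fatou g) (I2pi k) (I2pi l).
Proof.
wlog kl : k l / (k < l)%N => [hw kl|_].
  have [||//] := ltngtP k l; first by move/hw; apply.
  by move=> lk /connected_component_sym; apply: hw => // /esym.
move=> [A [Ak AF cA] Al].
have cI : connected [set complex.Im z | z in A].
  apply: connected_continuous_connected => //; apply: continuous_subspaceT => z.
  move=> V /nbhs_ballP [e /= e0 eV]; apply/nbhs_complexP; exists e => // w wz.
  apply: eV; rewrite -ball_normE /= distrC; apply: le_lt_trans wz.
  by have := normIm_le (w - z); case: (w) (z) => [? ?] [? ?].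
have /(_ (oddpi R k)) := (connected_intervalP _).1 cI _ _
  (ex_intro2 _ _ _ Ak erefl) (ex_intro2 _ _ _ Al erefl).
have p0 := @pi_gt0 R.
case.
  rewrite /= /oddpi -!pmulrn -mul2n -[(2 * k)%N.+1%:R]natr1 natrM.
  have : k.+1%:R <= l%:R :> R by rewrite ler_nat.
  rewrite -[k.+1%:R]natr1 => k1; apply/andP; split; first lra.
  by have := ler_wpM2r (ltW p0) k1; lra.
move=> [x y] Axy /= yE; apply: (@line_not_Fatou R k x); rewrite -yE; exact: AF.
Qed.

Lemma contraction_periodic (F : C -> C) : continuous F ->
  (forall w, nc w < 1 / 8 -> nc (F w) <= nc w / 2) -> lies_in (@periodic R) F trap.
Proof.
move=> cF attr; have r0 : 0 < 1 / 8 :> R by [].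
have attr' w : nc (w - 0) < 1 / 8 -> nc (F w - 0) <= nc (w - 0) / 2.
  by rewrite !subr0; exact: attr.
exists (connected_component (Fatou F) 0).
  exact: attracting_component_periodic cF r0 attr'.
apply: trap_component => w Dw; apply: (basin_Fatou cF r0 attr').
by exists 0%N; rewrite subr0.
Qed.

(** The composite sends the disc around [0] to the disc around [2 pi i], a
    superattracting fixed point. *)
Lemma wander_attract_preperiodic : lies_in (@preperiodic R) (g \o f) trap.
Proof.
pose p : C := I2pi 1; have r0 : 0 < 1 / 8 :> R by [].
have cgf : continuous (g \o f).
  move=> z; apply: continuous_comp; exact: expaff_continuous.
have gf_contract w : nc w < 1 / 8 -> nc ((g \o f) w - p) <= nc w / 2.
  move=> /ltW w8; have h1 := attract_contract w8; have n0 := normc_ge0 w.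
  rewrite /= wanderE addrK; apply: le_trans (newton_contract _) _; lra.
have attr (w : C) : nc (w - p) < 1 / 8 -> nc ((g \o f) w - p) <= nc (w - p) / 2.
  by move=> /gf_contract; rewrite /= -[in f w](subrK p w) attractD_I2pi.
have DB : trap `<=` basin (g \o f) p (1 / 8).
  move=> w Dw; exists 1%N; apply: le_lt_trans (gf_contract w Dw) _.
  by have := normc_ge0 w; rewrite /trap /= in Dw; lra.
exists (connected_component (Fatou (g \o f)) 0); last first.
  by apply: trap_component => w /DB/(basin_Fatou cgf r0 attr).
apply: (@preperiodic_component _ _ _ _ cgf r0 attr _ 1%N); first exact/DB/trap0.
by rewrite /= attract0 wanderE newton0 add0r.
Qed.

End Main.

Theorem theorem2p5 (R : realType) :
  exists (f g : R[i]^o -> R[i]^o) (D : set R[i]^o),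
    [/\ transcendental_entire f, transcendental_entire g & domain D] /\
    [/\ lies_in (@periodic R) f D,
        lies_in (@wandering R) g D,
        lies_in (@preperiodic R) (g \o f) D &
        lies_in (@periodic R) (f \o g) D].
Proof.
have cf : continuous (@attract R) by exact: expaff_continuous.
have cg : continuous (@wander R) by exact: expaff_continuous.
exists (@attract R), (@wander R), (@trap R); split; split.
- apply: expaff_transcendental; apply/eqP => /(congr1 (@complex.Re R)) /= /eqP.
  by rewrite mulf_eq0 oner_eq0 invr_eq0 pnatr_eq0.
- by apply: expaff_transcendental; rewrite oppr_eq0 oner_eq0.
- exact: domain_trap.
- by apply: contraction_periodic => // w /ltW; exact: attract_contract.
- exists (connected_component (Fatou (@wander R)) 0).
    apply: wandering_component => [|k l kl]; first exact/wander_trap_Fatou/trap0.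
    by rewrite !iter_wander0; exact: wander_components_differ.
  by apply: trap_component; exact: wander_trap_Fatou.
- exact: wander_attract_preperiodic.
- apply: contraction_periodic.
    by move=> z; apply: continuous_comp; [exact: cg|exact: cf].
  move=> w /ltW w8; rewrite /= wanderE attractD_I2pi.
  have h1 := newton_contract w8; have n0 := normc_ge0 w.
  by apply: le_trans (attract_contract _) _; lra.
Qed.
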